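(* Let $(H,[-,-,-])$ be a commutative and cocommutative Hopf heap. Then the set $E(H)$ of all endomorphisms of the commutative Hopf heap $H$ has a Hopf truss structure, whose multiplication $\circ$ is the composition of maps, whose comultiplication is defined by $\widetilde{\Delta}(\alpha)=\alpha\otimes\alpha$, and whose heap operation $\{-,-,-\}$ is given by $$\{\alpha,\beta,\gamma\}:H\to H,\qquad x\mapsto[\alpha(x_1),\beta(x_2),\gamma(x_3)],$$ for all $\alpha,\beta,\gamma\in E(H)$.
   Context: Everything is over a fixed field $\mathbf{k}$. Sweedler notation $\Delta(c)=c_1\otimes c_2$ is used; $C^{cop}$ is the co-opposite coalgebra of a coalgebra $C$. All coalgebras are assumed to have at least one group-like element. A Hopf heap is a coalgebra $C$ with a coalgebra map $C\otimes C^{cop}\otimes C\to C$, $a\otimes b\otimes c\mapsto[a,b,c]$, such that $[[a,b,c],d,h]=[a,b,[c,d,h]]$ and $[c_1,c_2,a]=[a,c_1,c_2]=\varepsilon(c)a$ for all $a,b,c,d,h\in C$. It is commutative if $[x,y,z]=[z,y,x]$ for all $x,y,z$, and cocommutative if its coalgebra is cocommutative. A Hopf heap homomorphism is a coalgebra map $f$ with $f([a,b,c])=[f(a),f(b),f(c)]$; an endomorphism of $H$ is a Hopf heap homomorphism $H\to H$. A Hopf truss is a Hopf heap $(H,[-,-,-])$ together with a multiplication $\circ$ making the same coalgebra a nonunital bialgebra $(H,\circ,\Delta,\varepsilon)$ (associative multiplication which is a coalgebra map, unit not required) such that $a\circ[b,c,d]=[a_1\circ b,a_2\circ c,a_3\circ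 d]$ for all $a,b,c,d\in H$. *)

(* Defs.v *)
From HB Require Import structures.
From mathcomp Require Import all_boot all_order all_algebra.
From mathcomp Require Import boolp.
From mathcomp Require Import finmap.
From mathcomp Require Import monalg.

Set Implicit Arguments.
Unset Strict Implicit.
Unset Printing Implicit Defensive.

Import GRing.Theory.
Import Quotient.

Local Open Scope ring_scope.
Local Open Scope quotient_scope.

Reserved Notation "V ⊗ W" (at level 40, left associativity).
Reserved Notation "v \ox w" (at level 40, left associativity).

(* {malg k[T]} is the free k-module on T, with basis << x >>. *)
Section FreeModule.
Variables (k : fieldType) (T : choiceType) (U : lmodType k).

Definition malg_lift (f : T -> U) (g : {malg k[T]}) : U :=
  \sum_(x <- msupp g) g@_x *: f x.

Lemma malg_liftEw (f : T -> U) (g : {malg k[T]}) (D : {fset T}) :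
  (msupp g `<=` D)%fset -> malg_lift f g = \sum_(x <- D) g@_x *: f x.
Proof.
move=> gD; rewrite /malg_lift [RHS](big_fsetID _ (mem (msupp g))) /=.
rewrite [X in _ = _ + X]big1_fset ?addr0; last first.
  by move=> x; rewrite !inE => /andP[_ /mcoeff_outdom ->]; rewrite scale0r.
apply: eq_fbigl => x; rewrite !inE /=.
by case: (boolP (x \in msupp g)) => [/(fsubsetP gD) ->|_]; rewrite ?andbF.
Qed.

Lemma malg_lift_is_linear (f : T -> U) : linear (malg_lift f).
Proof.
move=> a g h; pose D := (msupp g `|` msupp h `|` msupp (a *: g + h))%fset.
rewrite (@malg_liftEw f _ D) ?fsubsetUr//.
rewrite (@malg_liftEw f g D) 1?(fsubset_trans _ (fsubsetUl _ _)) ?fsubsetUl//.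
rewrite (@malg_liftEw f h D) 1?(fsubset_trans _ (fsubsetUl _ _)) ?fsubsetUr//.
rewrite scaler_sumr -big_split /=; apply: eq_bigr => x _.
by rewrite mcoeffD mcoeffZ scalerDl scalerA.
Qed.

HB.instance Definition _ (f : T -> U) :=
  GRing.isLinear.Build k {malg k[T]} U _ (malg_lift f)
    (malg_lift_is_linear f).

Lemma malg_liftU (f : T -> U) x : malg_lift f << x >> = f x.
Proof. by rewrite /malg_lift msuppU oner_eq0 big_seq_fset1 mcoeffUU scale1r. Qed.

End FreeModule.

Section Tensor.
Variables (k : fieldType) (V W : lmodType k).

(* The relations defining V ⊗ W as a quotient of the free module on V * W. *)
Inductive tensor_span : {malg k[(V * W)%type]} -> Prop :=
| TensorSpan0 : tensor_span 0
| TensorSpanP a x y : tensor_span x -> tensor_span y -> tensor_span (a *: x + y)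
| TensorSpanL a v v' w :
    tensor_span (<< (a *: v + v', w) >> - (a *: << (v, w) >> + << (v', w) >>))
| TensorSpanR a v w w' :
    tensor_span (<< (v, a *: w + w') >> - (a *: << (v, w) >> + << (v, w') >>)).

Definition tensor_rel : {pred {malg k[(V * W)%type]}} := fun x => `[< tensor_span x >].

Lemma tensor_rel_closed : zmod_closed tensor_rel.
Proof.
split=> [|x y /asboolP rx /asboolP ry]; apply/asboolP; first exact: TensorSpan0.
by rewrite addrC -scaleN1r; apply: TensorSpanP.
Qed.

HB.instance Definition _ :=
  GRing.isZmodClosed.Build {malg k[(V * W)%type]} tensor_rel tensor_rel_closed.

Definition tensor : Type := {quot tensor_rel}.
HB.instance Definition _ := GRing.Zmodule.on tensor.

Definition tensor_pi (x : {malg k[(V * W)%type]}) : tensor := \pi_{quot tensor_rel} x.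
Definition tensor_repr (t : tensor) : {malg k[(V * W)%type]} :=
  repr (t : {quot tensor_rel}).

Lemma tensor_reprK : cancel tensor_repr tensor_pi.
Proof. by move=> t; exact: reprK. Qed.

Lemma tensor_piP x y : tensor_pi x = tensor_pi y <-> tensor_span (x - y).
Proof.
split=> [/eqP|xy]; first by rewrite -idealrBE => /asboolP.
by apply/eqP; rewrite -idealrBE; apply/asboolP.
Qed.

Lemma tensor_piD x y : tensor_pi (x + y) = tensor_pi x + tensor_pi y.
Proof. exact: raddfD. Qed.

Definition tensor_scale (a : k) (t : tensor) : tensor :=
  tensor_pi (a *: tensor_repr t).

Lemma tensor_scale_pi a x : tensor_scale a (tensor_pi x) = tensor_pi (a *: x).
Proof.
apply/tensor_piP; rewrite -scalerBr -[X in tensor_span X]addr0.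
by apply: TensorSpanP TensorSpan0; apply/tensor_piP; rewrite tensor_reprK.
Qed.

Fact tensor_scaleA a b t :
  tensor_scale a (tensor_scale b t) = tensor_scale (a * b) t.
Proof. by rewrite -[t]tensor_reprK !tensor_scale_pi scalerA. Qed.

Fact tensor_scale1 : left_id 1 tensor_scale.
Proof. by move=> t; rewrite -[t]tensor_reprK tensor_scale_pi scale1r. Qed.

Fact tensor_scaleDr : right_distributive tensor_scale +%R.
Proof.
move=> a t u; rewrite -[t]tensor_reprK -[u]tensor_reprK.
by rewrite !(=^~ tensor_piD, tensor_scale_pi) scalerDr.
Qed.

Fact tensor_scaleDl t : {morph tensor_scale^~ t : a b / a + b}.
Proof.
move=> a b; rewrite -[t]tensor_reprK.
by rewrite !(=^~ tensor_piD, tensor_scale_pi) scalerDl.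
Qed.

HB.instance Definition _ := GRing.Zmodule_isLmodule.Build k tensor
  tensor_scaleA tensor_scale1 tensor_scaleDr tensor_scaleDl.

Lemma tensor_piZ a x : tensor_pi (a *: x) = a *: tensor_pi x.
Proof. by rewrite -tensor_scale_pi. Qed.

End Tensor.

HB.lock Definition tprod (k : fieldType) (V W : lmodType k) (v : V) (w : W) :
  tensor V W := tensor_pi << (v, w) >>.

Section TensorProduct.
Variables (k : fieldType) (V W : lmodType k).
Local Notation tensor := (tensor V W).
Local Notation tprod := (@tprod k V W).

Lemma tprodE v w : tprod v w = tensor_pi << (v, w) >>.
Proof. by rewrite unlock. Qed.

Lemma tprod_is_bilinear : bilinear_for *:%R *:%R tprod.
Proof.
split=> [w a v v'|v a w w'] /=; rewrite !tprodE -tensor_piZ -tensor_piD;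
  apply/tensor_piP; [exact: TensorSpanL | exact: TensorSpanR].
Qed.

HB.instance Definition _ := bilinear_isBilinear.Build k V W tensor
  _ _ tprod tprod_is_bilinear.

Lemma tprodPl w a v v' : tprod (a *: v + v') w = a *: tprod v w + tprod v' w.
Proof. exact: linearPl. Qed.

Lemma tprodPr v a w w' : tprod v (a *: w + w') = a *: tprod v w + tprod v w'.
Proof. exact: linearPr. Qed.

Lemma tprodDl w v v' : tprod (v + v') w = tprod v w + tprod v' w.
Proof. exact: linearDl. Qed.

Lemma tprodDr v w w' : tprod v (w + w') = tprod v w + tprod v w'.
Proof. exact: linearDr. Qed.

Lemma tprodZl a v w : tprod (a *: v) w = a *: tprod v w.
Proof. exact: linearZl_LR. Qed.

Lemma tprodZr a v w : tprod v (a *: w) = a *: tprod v w.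
Proof. exact: linearZr_LR. Qed.

Lemma tensor_ind (P : tensor -> Prop) :
  (forall v w, P (tprod v w)) -> (forall t u, P t -> P u -> P (t + u)) ->
  forall t, P t.
Proof.
move=> Ptprod PD t; rewrite -[t]tensor_reprK; move: (tensor_repr t) => x.
have P0 : P 0 by rewrite -(linear0l tprod 0); exact: Ptprod.
rewrite [x]monalgE; elim/big_rec: _ => [|[v w] y _ Py].
  by rewrite -(scale0r 0) tensor_piZ scale0r.
rewrite tensor_piD; apply: PD Py.
suff -> : << x@_(v, w) *g (v, w) >> =
    x@_(v, w) *: << (v, w) >> :> {malg k[(V * W)%type]}.
  rewrite tensor_piZ -tprodE.
  by rewrite -tprodZl; exact: Ptprod.
by apply/malgP => z; rewrite mcoeffZ !mcoeffU mulrnAr mulr1.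
Qed.

End TensorProduct.

Notation "V ⊗ W" := (tensor V W) : type_scope.
Notation "V ⊗ W" := (tensor V W) : ring_scope.
Notation "v \ox w" := (tprod v w) : ring_scope.

Section TensorLift.
Variables (k : fieldType) (V W U : lmodType k).
Variable f : {bilinear V -> W -> U}.

Definition tlift_fun (t : V ⊗ W) : U :=
  malg_lift (fun p : V * W => f p.1 p.2) (tensor_repr t).

Lemma tlift_span x : tensor_span x ->
  malg_lift (fun p : V * W => f p.1 p.2) x = 0.
Proof.
elim=> [|a y z _ y0 _ z0|a v v' w|a v w w'].
- exact: linear0.
- by rewrite linearP /= y0 z0 scaler0 addr0.
- by rewrite linearB linearP /= !malg_liftU /= linearPl subrr.
- by rewrite linearB linearP /= !malg_liftU /= linearPr subrr.
Qed.

Lemma tlift_pi x :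
  tlift_fun (tensor_pi x) = malg_lift (fun p : V * W => f p.1 p.2) x.
Proof.
apply/eqP; rewrite /tlift_fun -subr_eq0 -linearB; apply/eqP/tlift_span.
by apply/tensor_piP; rewrite tensor_reprK.
Qed.

Lemma tlift_is_linear : linear tlift_fun.
Proof.
move=> a t u; rewrite -[t]tensor_reprK -[u]tensor_reprK.
by rewrite -tensor_piZ -tensor_piD !tlift_pi linearP.
Qed.

HB.instance Definition _ := GRing.isLinear.Build k (V ⊗ W) U _ tlift_fun
  tlift_is_linear.

End TensorLift.

HB.lock Definition tlift (k : fieldType) (V W U : lmodType k)
  (f : {bilinear V -> W -> U}) : {linear V ⊗ W -> U} := tlift_fun f.

Section TensorLiftTheory.
Variables (k : fieldType) (V W U : lmodType k).
Variable f : {bilinear V -> W -> U}.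

Lemma tliftE v w : tlift f (v \ox w) = f v w.
Proof. by rewrite unlock /= tprodE tlift_pi malg_liftU. Qed.

Lemma tliftD t u : tlift f (t + u) = tlift f t + tlift f u.
Proof. exact: linearD. Qed.

End TensorLiftTheory.

Lemma tensor_linearP (k : fieldType) (V W U : lmodType k)
    (f g : {linear V ⊗ W -> U}) :
  (forall v w, f (v \ox w) = g (v \ox w)) -> f =1 g.
Proof.
move=> fg t; elim/tensor_ind: t => [//|t u ft fu].
by rewrite !linearD ft fu.
Qed.

Section Map.
Variables (k : fieldType) (V W V' W' : lmodType k).
Variables (f : {linear V -> V'}) (g : {linear W -> W'}).
Definition tmap_fun (v : V) (w : W) : V' ⊗ W' := f v \ox g w.
Lemma tmap_is_bilinear : bilinear_for *:%R *:%R tmap_fun.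
Proof.
by split=> [w a v v'|v a w w']; rewrite /tmap_fun linearP (tprodPl, tprodPr).
Qed.
HB.instance Definition _ := bilinear_isBilinear.Build k V W (V' ⊗ W')
  _ _ tmap_fun tmap_is_bilinear.
End Map.

HB.lock Definition tmap (k : fieldType) (V W V' W' : lmodType k)
  (f : {linear V -> V'}) (g : {linear W -> W'}) :
  {linear V ⊗ W -> V' ⊗ W'} := tlift (tmap_fun f g).

Section Swap.
Variables (k : fieldType) (V W : lmodType k).
Definition tswap_fun (v : V) (w : W) : W ⊗ V := w \ox v.
Lemma tswap_is_bilinear : bilinear_for *:%R *:%R tswap_fun.
Proof.
by split=> [w a v v'|v a w w']; rewrite /tswap_fun (tprodPl, tprodPr).
Qed.
HB.instance Definition _ := bilinear_isBilinear.Build k V W (W ⊗ V)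
  _ _ tswap_fun tswap_is_bilinear.
End Swap.

HB.lock Definition tswap (k : fieldType) (V W : lmodType k) :
  {linear V ⊗ W -> W ⊗ V} := tlift (@tswap_fun k V W).

Section Assoc.
Variables (k : fieldType) (V W U : lmodType k).
Definition tassoc_in (u : U) : V -> W -> V ⊗ (W ⊗ U) := fun v w => v \ox (w \ox u).
Lemma tassoc_in_is_bilinear u : bilinear_for *:%R *:%R (tassoc_in u).
Proof.
by split=> [w a v v'|v a w w']; rewrite /tassoc_in ?tprodPl// tprodPr.
Qed.
HB.instance Definition _ u := bilinear_isBilinear.Build k V W (V ⊗ (W ⊗ U))
  _ _ (tassoc_in u) (tassoc_in_is_bilinear u).
Definition tassoc_fun (t : V ⊗ W) (u : U) : V ⊗ (W ⊗ U) :=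
  tlift (tassoc_in u) t.
Lemma tassoc_is_bilinear : bilinear_for *:%R *:%R tassoc_fun.
Proof.
split=> [u a t t'|t a u u']; rewrite /tassoc_fun; first by rewrite linearP.
elim/tensor_ind: t => [v w|t t' IH IH'].
  by rewrite !tliftE /= /tassoc_in !tprodPr.
by rewrite !tliftD IH IH' /= scalerDr addrACA.
Qed.
HB.instance Definition _ := bilinear_isBilinear.Build k (V ⊗ W) U
  (V ⊗ (W ⊗ U)) _ _ tassoc_fun tassoc_is_bilinear.
End Assoc.

HB.lock Definition tassoc (k : fieldType) (V W U : lmodType k) :
  {linear (V ⊗ W) ⊗ U -> V ⊗ (W ⊗ U)} := tlift (@tassoc_fun k V W U).

Section Interchange.
Variables (k : fieldType) (V W U X : lmodType k).
Definition tmid_in (u : U) (x : X) : V -> W -> (V ⊗ U) ⊗ (W ⊗ X) :=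
  fun v w => (v \ox u) \ox (w \ox x).
Lemma tmid_in_is_bilinear u x : bilinear_for *:%R *:%R (tmid_in u x).
Proof.
by split=> [w a v v'|v a w w']; rewrite /tmid_in tprodPl ?tprodPl ?tprodPr.
Qed.
HB.instance Definition _ u x := bilinear_isBilinear.Build k V W
  ((V ⊗ U) ⊗ (W ⊗ X)) _ _ (tmid_in u x) (tmid_in_is_bilinear u x).
Definition tmid_out (t : V ⊗ W) (u : U) (x : X) : (V ⊗ U) ⊗ (W ⊗ X) :=
  tlift (tmid_in u x) t.
Lemma tmid_out_is_bilinear t : bilinear_for *:%R *:%R (tmid_out t).
Proof.
split=> [x a u u'|u a x x']; rewrite /tmid_out.
  elim/tensor_ind: t => [v w|t t' IH IH'].
    by rewrite !tliftE /= /tmid_in tprodPr tprodPl.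
  by rewrite !tliftD IH IH' /= scalerDr addrACA.
elim/tensor_ind: t => [v w|t t' IH IH'].
  by rewrite !tliftE /= /tmid_in !tprodPr.
by rewrite !tliftD IH IH' /= scalerDr addrACA.
Qed.
HB.instance Definition _ t := bilinear_isBilinear.Build k U X
  ((V ⊗ U) ⊗ (W ⊗ X)) _ _ (tmid_out t) (tmid_out_is_bilinear t).
Definition tmid_fun (t : V ⊗ W) (y : U ⊗ X) : (V ⊗ U) ⊗ (W ⊗ X) :=
  tlift (tmid_out t) y.
Lemma tmid_is_bilinear : bilinear_for *:%R *:%R tmid_fun.
Proof.
split=> [y a t t'|t a y y']; rewrite /tmid_fun; last by rewrite linearP.
elim/tensor_ind: y => [u x|y y' IH IH'].
  by rewrite !tliftE /= /tmid_out linearP.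
by rewrite !tliftD IH IH' /= scalerDr addrACA.
Qed.
HB.instance Definition _ := bilinear_isBilinear.Build k (V ⊗ W) (U ⊗ X)
  ((V ⊗ U) ⊗ (W ⊗ X)) _ _ tmid_fun tmid_is_bilinear.
End Interchange.

HB.lock Definition tmid (k : fieldType) (V W U X : lmodType k) :
  {linear (V ⊗ W) ⊗ (U ⊗ X) -> (V ⊗ U) ⊗ (W ⊗ X)} := tlift (@tmid_fun k V W U X).

Section Unit.
Variables (k : fieldType) (V : lmodType k).
Definition tunitl_fun (a : k^o) (v : V) : V := a *: v.
Lemma tunitl_is_bilinear : bilinear_for *:%R *:%R tunitl_fun.
Proof.
split=> [v a b c|a b v v']; rewrite /tunitl_fun.
  by rewrite scalerDl -scalerA.
by rewrite /= scalerDr !scalerA mulrC.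
Qed.
HB.instance Definition _ := bilinear_isBilinear.Build k k^o V V
  _ _ tunitl_fun tunitl_is_bilinear.
End Unit.

HB.lock Definition tunitl (k : fieldType) (V : lmodType k) :
  {linear k^o ⊗ V -> V} := tlift (@tunitl_fun k V).

HB.lock Definition tunitr (k : fieldType) (V : lmodType k) :
  {linear V ⊗ k^o -> V} :=
  @tunitl k V \o @tswap k V k^o.

Arguments tswap {k V W}.
Arguments tassoc {k V W U}.
Arguments tmid {k V W U X}.
Arguments tunitl {k V}.
Arguments tunitr {k V}.

Section TensorMapsTheory.
Variables (k : fieldType) (V W U X : lmodType k).
Implicit Types (v : V) (w : W) (u : U) (x : X).

Lemma tmapE (f : {linear V -> U}) (g : {linear W -> X}) v w :
  tmap f g (v \ox w) = f v \ox g w.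
Proof. by rewrite tmap.unlock tliftE. Qed.

Lemma tswapE v w : tswap (v \ox w) = w \ox v.
Proof. by rewrite tswap.unlock tliftE. Qed.

Lemma tassocE v w u : tassoc ((v \ox w) \ox u) = v \ox (w \ox u).
Proof. by rewrite tassoc.unlock tliftE /= /tassoc_fun tliftE. Qed.

Lemma tmidE v w u x : tmid ((v \ox w) \ox (u \ox x)) = (v \ox u) \ox (w \ox x).
Proof. by rewrite tmid.unlock tliftE /= /tmid_fun tliftE /= /tmid_out tliftE. Qed.

Lemma tunitlE a v : tunitl (a \ox v) = a *: v.
Proof. by rewrite tunitl.unlock tliftE. Qed.

End TensorMapsTheory.

Lemma tunitrE (k : fieldType) (V : lmodType k) (v : V) (a : k^o) : tunitr (v \ox a) = a *: v.
Proof.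
rewrite tunitr.unlock; apply: etrans (tunitlE a v).
by apply: (congr1 tunitl); apply: tswapE.
Qed.

Lemma tensor2_linearP (k : fieldType) (V W U X Y : lmodType k)
    (f g : {linear (V ⊗ W) ⊗ (U ⊗ X) -> Y}) :
  (forall v w u x, f ((v \ox w) \ox (u \ox x)) = g ((v \ox w) \ox (u \ox x))) ->
  f =1 g.
Proof.
move=> fg; apply: tensor_linearP => s t.
elim/tensor_ind: s => [v w|s s' IH IH']; last by rewrite tprodDl !linearD IH IH'.
elim/tensor_ind: t => [u x|t t' IH IH']; last by rewrite tprodDr !linearD IH IH'.
exact: fg.
Qed.

Section Coalgebra.
Variable k : fieldType.

(* The existence of a group-like element is part of the structure. *)
Record coalgebra (V : lmodType k) := Coalgebra {
  comul : {linear V -> V ⊗ V};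
  counit : {linear V -> k^o};
  comulA : forall c,
    tassoc (tmap comul idfun (comul c)) = tmap idfun comul (comul c);
  counitl : forall c, tunitl (tmap counit idfun (comul c)) = c;
  counitr : forall c, tunitr (tmap idfun counit (comul c)) = c;
  grouplike_ex : exists g, comul g = g \ox g /\ counit g = 1
}.

(* c |-> c_1 ⊗ (c_2 ⊗ c_3) *)
Definition comul3 (V : lmodType k) (C : coalgebra V) :
  {linear V -> V ⊗ (V ⊗ V)} := tmap idfun (comul C) \o comul C.

Definition cocommutative (V : lmodType k) (C : coalgebra V) :=
  forall c, tswap (comul C c) = comul C c.

Definition coalgebra_hom (V W : lmodType k) (C : coalgebra V) (D : coalgebra W)
    (f : {linear V -> W}) :=
  (forall c, comul D (f c) = tmap f f (comul C c)) /\
  (forall c, counit D (f c) = counit C c).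

Section Cop.
Variables (V : lmodType k) (C : coalgebra V).

Definition cop_comul : {linear V -> V ⊗ V} := tswap \o comul C.

Fact cop_comulA c :
  tassoc (tmap cop_comul idfun (cop_comul c)) =
  tmap idfun cop_comul (cop_comul c).
Proof.
pose rev := tassoc \o tswap \o tmap idfun tswap : {linear V ⊗ (V ⊗ V) -> _}.
have l : tassoc \o tmap cop_comul idfun \o tswap =1 rev \o tmap idfun (comul C).
  by apply: tensor_linearP => v w /=; rewrite tswapE !tmapE /= tswapE.
have r : tmap idfun cop_comul \o tswap =1 rev \o (tassoc \o tmap (comul C) idfun).
  apply: tensor_linearP => v w /=; rewrite tswapE !tmapE /=.
  elim/tensor_ind: (comul C v) => [a b|x y IHx IHy].
    by rewrite tassocE tmapE !tswapE tassocE.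
  by rewrite tprodDl !linearD tprodDr /= -IHx -IHy.
by have := l (comul C c); rewrite /= -comulA => ->; have := r (comul C c).
Qed.

Fact cop_counitl c : tunitl (tmap (counit C) idfun (cop_comul c)) = c.
Proof.
have e : @tunitl k V \o tmap (counit C) idfun \o tswap =1
         @tunitr k V \o tmap idfun (counit C).
  by apply: tensor_linearP => v w /=; rewrite tswapE !tmapE tunitlE tunitrE.
by rewrite -[RHS](counitr C) -[RHS]e.
Qed.

Fact cop_counitr c : tunitr (tmap idfun (counit C) (cop_comul c)) = c.
Proof.
have e : @tunitr k V \o tmap idfun (counit C) \o tswap =1
         @tunitl k V \o tmap (counit C) idfun.
  by apply: tensor_linearP => v w /=; rewrite tswapE !tmapE tunitlE tunitrE.
by rewrite -[RHS](counitl C) -[RHS]e.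
Qed.

Fact cop_grouplike_ex : exists g, cop_comul g = g \ox g /\ counit C g = 1.
Proof.
by have [g [Dg eg]] := grouplike_ex C; exists g; rewrite /= Dg tswapE.
Qed.

Definition cop : coalgebra V :=
  Coalgebra cop_comulA cop_counitl cop_counitr cop_grouplike_ex.

End Cop.

Section TensorCoalgebra.
Variables (V W : lmodType k) (C : coalgebra V) (D : coalgebra W).

Definition tensor_comul : {linear V ⊗ W -> (V ⊗ W) ⊗ (V ⊗ W)} :=
  tmid \o tmap (comul C) (comul D).

Definition tensor_counit : {linear V ⊗ W -> k^o} :=
  tunitl \o tmap (counit C) (counit D).

Lemma tensor_comulE c d : tensor_comul (c \ox d) = tmid (comul C c \ox comul D d).
Proof. by rewrite /= tmapE. Qed.

Lemma tensor_counitE c d : tensor_counit (c \ox d) = counit C c * counit D d.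
Proof. by rewrite /= tmapE tunitlE. Qed.

Fact tensor_comulA t :
  tassoc (tmap tensor_comul idfun (tensor_comul t)) =
  tmap idfun tensor_comul (tensor_comul t).
Proof.
pose mid3 := tmap idfun tmid \o tmid :
  {linear (V ⊗ (V ⊗ V)) ⊗ (W ⊗ (W ⊗ W)) -> _}.
have l : tassoc \o tmap tensor_comul idfun \o tmid =1
    mid3 \o tmap (tassoc \o tmap (comul C) idfun) (tassoc \o tmap (comul D) idfun).
  apply: tensor2_linearP => a b a' b' /=; rewrite tmidE !tmapE /= !tmapE.
  elim/tensor_ind: (comul C a) => [p q|x y IHx IHy]; last first.
    by rewrite !(tprodDl, linearD) /= IHx IHy.
  elim/tensor_ind: (comul D a') => [p' q'|x y IHx IHy]; last first.
    by rewrite !(tprodDl, tprodDr, linearD) /= IHx IHy.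
  by rewrite !(tmidE, tassocE) tmapE /= tmidE.
have r : tmap idfun tensor_comul \o tmid =1
    mid3 \o tmap (tmap idfun (comul C)) (tmap idfun (comul D)).
  apply: tensor2_linearP => a b a' b' /=.
  by rewrite !(tmidE, tmapE) /= !tmapE.
elim/tensor_ind: t => [c d|t u IHt IHu]; last by rewrite !linearD IHt IHu.
rewrite tensor_comulE.
have /= -> := l (comul C c \ox comul D d).
have /= -> := r (comul C c \ox comul D d).
by rewrite !tmapE /= !comulA.
Qed.

Fact tensor_counitl t : tunitl (tmap tensor_counit idfun (tensor_comul t)) = t.
Proof.
have e : tunitl \o tmap tensor_counit idfun \o tmid =1
    tmap (@tunitl k V \o tmap (counit C) idfun) (@tunitl k W \o tmap (counit D) idfun).
  apply: tensor2_linearP => a b a' b' /=.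
  rewrite tmidE !tmapE tensor_counitE /= !tmapE !tunitlE.
  by rewrite tprodZl tprodZr scalerA.
elim/tensor_ind: t => [c d|t u IHt IHu]; last by rewrite !linearD IHt IHu.
rewrite tensor_comulE; have /= -> := e (comul C c \ox comul D d).
by rewrite tmapE /= !counitl.
Qed.

Fact tensor_counitr t : tunitr (tmap idfun tensor_counit (tensor_comul t)) = t.
Proof.
have e : tunitr \o tmap idfun tensor_counit \o tmid =1
    tmap (@tunitr k V \o tmap idfun (counit C)) (@tunitr k W \o tmap idfun (counit D)).
  apply: tensor2_linearP => a b a' b' /=.
  rewrite tmidE !tmapE tensor_counitE /= !tmapE !tunitrE.
  by rewrite tprodZl tprodZr scalerA.
elim/tensor_ind: t => [c d|t u IHt IHu]; last by rewrite !linearD IHt IHu.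
rewrite tensor_comulE; have /= -> := e (comul C c \ox comul D d).
by rewrite tmapE /= !counitr.
Qed.

Fact tensor_grouplike_ex :
  exists g, tensor_comul g = g \ox g /\ tensor_counit g = 1.
Proof.
have [g [Dg eg]] := grouplike_ex C; have [h [Dh eh]] := grouplike_ex D.
exists (g \ox h); rewrite tensor_comulE tensor_counitE Dg Dh tmidE eg eh.
by rewrite mulr1.
Qed.

Definition tensor_coalgebra : coalgebra (V ⊗ W) :=
  Coalgebra tensor_comulA tensor_counitl tensor_counitr tensor_grouplike_ex.

End TensorCoalgebra.

End Coalgebra.

Definition heap (k : fieldType) (V : lmodType k)
  (br : {linear V ⊗ (V ⊗ V) -> V}) (a b c : V) : V := br (a \ox (b \ox c)).

Record hopf_heap (k : fieldType) (V : lmodType k) (C : coalgebra V) := HopfHeap {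
  bracket : {linear V ⊗ (V ⊗ V) -> V};
  bracket_hom :
    coalgebra_hom (tensor_coalgebra C (tensor_coalgebra (cop C) C)) C bracket;
  heapA : forall a b c d h,
    heap bracket (heap bracket a b c) d h =
    heap bracket a b (heap bracket c d h);
  (* [c_1, c_2, a] = ε(c) a *)
  heapl : forall c a, bracket (tassoc (comul C c \ox a)) = counit C c *: a;
  (* [a, c_1, c_2] = ε(c) a *)
  heapr : forall c a, bracket (a \ox comul C c) = counit C c *: a
}.

Section HopfHeap.
Variables (k : fieldType) (V : lmodType k) (C : coalgebra V) (B : hopf_heap C).

Definition heap_commutative :=
  forall a b c, heap (bracket B) a b c = heap (bracket B) c b a.

Record heap_endo := HeapEndo {
  endo_map :> {linear V -> V};
  endo_coalgebra_hom : coalgebra_hom C C endo_map;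
  endo_heap : forall a b c,
    endo_map (heap (bracket B) a b c) =
    heap (bracket B) (endo_map a) (endo_map b) (endo_map c)
}.

Lemma heap_endoP (f g : heap_endo) : f =1 g -> f = g.
Proof.
case: f g => [f cf hf] [g cg hg] /= fg.
have fgE : f = g.
  case: f g fg {cf hf cg hg} => [f cf] [g cg] /= /funext fg.
  move: cg; rewrite -fg => cg; congr GRing.Linear.Pack; move: cf cg.
  move=> [[a] [b]] [[a'] [b']].
  by rewrite (Prop_irrelevance a a') (Prop_irrelevance b b').
move: cg hg; rewrite -fgE => cg hg.
by congr HeapEndo; exact: Prop_irrelevance.
Qed.

(* malg needs a choiceType as its basis. *)
HB.instance Definition _ := gen_eqMixin heap_endo.
HB.instance Definition _ := gen_choiceMixin heap_endo.

End HopfHeap.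

Section RightMultiplication.
Variables (k : fieldType) (V : lmodType k) (m : {linear V ⊗ V -> V}).

Definition rmul (b a : V) : V := m (a \ox b).

Fact rmul_is_linear b : linear (rmul b).
Proof. by move=> x a a'; rewrite /rmul tprodPl linearP. Qed.

HB.instance Definition _ b :=
  GRing.isLinear.Build k V V _ (rmul b) (rmul_is_linear b).

End RightMultiplication.

Record nonunital_bialgebra (k : fieldType) (V : lmodType k) (C : coalgebra V) :=
  NonunitalBialgebra {
  bialg_mul : {linear V ⊗ V -> V};
  bialg_mul_hom : coalgebra_hom (tensor_coalgebra C C) C bialg_mul;
  bialg_mulA : forall a b c,
    bialg_mul (a \ox bialg_mul (b \ox c)) = bialg_mul (bialg_mul (a \ox b) \ox c)
}.

Record hopf_truss (k : fieldType) (V : lmodType k) := HopfTruss {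
  truss_coalgebra : coalgebra V;
  truss_heap : hopf_heap truss_coalgebra;
  truss_bialgebra : nonunital_bialgebra truss_coalgebra;
  (* a ∘ [b, c, d] = [a_1 ∘ b, a_2 ∘ c, a_3 ∘ d] *)
  truss_distr : forall a b c d,
    let m := bialg_mul truss_bialgebra in
    m (a \ox heap (bracket truss_heap) b c d) =
    bracket truss_heap
      (tmap (rmul m b) (tmap (rmul m c) (rmul m d)) (comul3 truss_coalgebra a))
}.

(* Main.v *)
From HB Require Import structures.
Require Import Defs.
From mathcomp Require Import all_boot all_order all_algebra.
From mathcomp Require Import boolp finmap monalg.

Set Implicit Arguments.
Unset Strict Implicit.
Unset Printing Implicit Defensive.

(** Cocommutative coalgebras form a category with finite products given by the
tensor product, and a cocommutative Hopf heap [C] is a heap object in it.  So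
for every cocommutative [D] the set of coalgebra maps [D -> C] is an ordinary
heap for the convolution bracket, abelian when [C] is commutative, and [E(H)]
sits inside the case [D = C], where it inherits the heap identities.  That the
bracket of three endomorphisms is again an endomorphism is the medial law of
abelian heaps, applied on [D = C ⊗ (C ⊗ C)] to the three projections, whose
convolution bracket is the bracket of [C] itself.  The resulting set-level
truss on [E(H)] is then extended linearly. *)

Import GRing.Theory.

Local Open Scope ring_scope.

(** * Abelian heaps and the medial law *)

Section AbelianHeap.
Variables (T : Type) (op : T -> T -> T -> T).
Hypothesis opA : forall a b c d e, op (op a b c) d e = op a b (op c d e).
Hypothesis opl : forall a b, op a a b = b.
Hypothesis opr : forall a b, op b a a = b.
Hypothesis opC : forall a b c, op a b c = op c b a.

(** With [op a b c] read as [a b^-1 c] in a group, this is the rule inverting a product. *)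
Lemma heap_op_mid a b c d e : op a (op b c d) e = op (op a d c) b e.
Proof.
(* In this form [a] ends in [op b c d], which then cancels against the middle argument. *)
have {1}-> : a = op (op a d c) b (op b c d) by rewrite opA -(opA c) opr opl opr.
by rewrite opA opl.
Qed.

(** In the alternating sum x - b + c - d + e this lemma exchanges two added terms and
    [heap_swap_even] two subtracted ones. Rebracketing puts the two terms at the ends of one
    bracket, where [opC] applies. *)
Lemma heap_swap_odd x b c d e : op (op x b c) d e = op (op x b e) d c.
Proof. by rewrite !opA (opC c). Qed.

Lemma heap_swap_even x b c d e : op (op x b c) d e = op (op x d c) b e.
Proof. by rewrite -!heap_op_mid (opC d). Qed.

(** The nine elements form a 3 by 3 array, bracketed by rows on one side and by columns on the
    other. Both expand to the sum in which the entry in row r and column s has sign (-1)^(r+s), and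
    transposition preserves this sign. *)
Lemma heap_medial a b c d e f g h i :
  op (op a b c) (op d e f) (op g h i) = op (op a d g) (op b e h) (op c f i).
Proof.
have sw x p q r s : op (op x p q) r s = op (op x r s) p q.
  by rewrite heap_swap_even heap_swap_odd.
rewrite !heap_op_mid -!opA.
(* Both sides are now [a] followed by four pairs of a subtracted and an added term, so only
   permutations remain. *)
rewrite (sw (op a b c)) (sw a b c) (heap_swap_even _ f e h i).
by rewrite (sw (op a d g) b c).
Qed.

End AbelianHeap.

(** * Extensionality of linear maps and functoriality of the tensor product *)

Lemma linear_ext (k : fieldType) (V W : lmodType k) (f g : {linear V -> W}) :
  f =1 g -> f = g.
Proof.
case: f g => [f [[af] [sf]]] [g [[ag] [sg]]] /= /funext fg.
move: ag sg; rewrite -fg => ag sg.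
by rewrite (Prop_irrelevance af ag) (Prop_irrelevance sf sg).
Qed.

Lemma eq_tmap (k : fieldType) (V W V' W' : lmodType k)
    (f f' : {linear V -> V'}) (g g' : {linear W -> W'}) :
  f =1 f' -> g =1 g' -> tmap f g =1 tmap f' g'.
Proof.
by move=> ff gg; apply: tensor_linearP => v w; rewrite !tmapE ff gg.
Qed.

Lemma tmap_id (k : fieldType) (V W : lmodType k) (t : V ⊗ W) :
  tmap idfun idfun t = t.
Proof.
apply: (@tensor_linearP _ _ _ _ (tmap idfun idfun) idfun) => v w.
by rewrite tmapE.
Qed.

Lemma tmap_comp (k : fieldType) (V W V' W' V'' W'' : lmodType k)
    (f : {linear V -> V'}) (g : {linear W -> W'})
    (f' : {linear V' -> V''}) (g' : {linear W' -> W''}) t :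
  tmap f' g' (tmap f g t) = tmap (f' \o f) (g' \o g) t.
Proof.
have /= := @tensor_linearP _ _ _ _ (tmap f' g' \o tmap f g)
  (tmap (f' \o f) (g' \o g)); apply.
by move=> v w /=; rewrite !tmapE.
Qed.

(** * Coalgebra maps and pairings *)

Section CoalgebraHom.
Variable k : fieldType.
Implicit Types V W U X : lmodType k.

Lemma coalgebra_hom_id V (C : coalgebra V) : coalgebra_hom C C idfun.
Proof.
by split=> // c; rewrite tmap_id.
Qed.

Lemma coalgebra_hom_comp V W U (C : coalgebra V) (D : coalgebra W)
    (E : coalgebra U) (f : {linear W -> U}) (g : {linear V -> W}) :
  coalgebra_hom D E f -> coalgebra_hom C D g -> coalgebra_hom C E (f \o g).
Proof.
move=> [fD fe] [gD ge]; split=> c /=; last by rewrite fe ge.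
by rewrite fD gD tmap_comp.
Qed.

Lemma coalgebra_hom_tmap V W U X (C : coalgebra V) (D : coalgebra W)
    (E : coalgebra U) (F : coalgebra X)
    (f : {linear V -> U}) (g : {linear W -> X}) :
  coalgebra_hom C E f -> coalgebra_hom D F g ->
  coalgebra_hom (tensor_coalgebra C D) (tensor_coalgebra E F) (tmap f g).
Proof.
move=> [fD fe] [gD ge]; split.
  apply: (@tensor_linearP _ _ _ _ (_ \o tmap f g) (tmap _ _ \o _)) => v w /=.
  rewrite !tmapE fD gD.
  have e : tmid \o tmap (tmap f f) (tmap g g) =1
      tmap (tmap f g) (tmap f g) \o tmid.
    by apply: tensor2_linearP => a b c d /=; rewrite !(tmidE, tmapE).
  by have /= := e (comul C v \ox comul D w); rewrite tmapE.
apply: (@tensor_linearP _ _ _ _ (_ \o tmap f g) _) => v w /=.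
by rewrite !tmapE fe ge.
Qed.

(** The map x ↦ f(x_1) ⊗ g(x_2). For coalgebra maps out of a cocommutative [C] it is the induced map
    into the categorical product. *)
Definition tpair V W U (C : coalgebra V) (f : {linear V -> W})
  (g : {linear V -> U}) : {linear V -> W ⊗ U} := tmap f g \o comul C.

Section Pairing.
Variables (V W U : lmodType k) (C : coalgebra V).
Variables (f : {linear V -> W}) (g : {linear V -> U}).

Lemma tmap_tpair (W' U' : lmodType k) (f' : {linear W -> W'})
    (g' : {linear U -> U'}) x :
  tmap f' g' (tpair C f g x) = tpair C (f' \o f) (g' \o g) x.
Proof. by rewrite /= tmap_comp. Qed.

Lemma tpair_comp (V' : lmodType k) (D : coalgebra V') (u : {linear V' -> V}) x :
  coalgebra_hom D C u ->
  tpair C f g (u x) = tpair D (f \o u) (g \o u) x.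
Proof. by case=> uD _; rewrite /= uD tmap_comp. Qed.

(** Coassociativity of [C], transported along the three maps. *)
Lemma tpair_assoc (X : lmodType k) (h : {linear V -> X}) x :
  tassoc (tpair C (tpair C f g) h x) = tpair C f (tpair C g h) x.
Proof.
have l : tmap f (tmap g h) \o tassoc =1 tassoc \o tmap (tmap f g) h.
  apply: tensor_linearP => t c /=; elim/tensor_ind: t => [a b|s t IHs IHt].
    by rewrite !(tmapE, tassocE).
  by rewrite tprodDl !linearD IHs IHt.
have r : tmap (tpair C f g) h =1 tmap (tmap f g) h \o tmap (comul C) idfun.
  by move=> t /=; rewrite tmap_comp; apply: eq_tmap.
have /= -> := r (comul C x); have /= <- := l (tmap (comul C) idfun (comul C x)).
by rewrite comulA tmap_comp; apply: eq_tmap.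
Qed.

Lemma tpair_swap x : cocommutative C -> tswap (tpair C f g x) = tpair C g f x.
Proof.
move=> cC; rewrite /= -[in RHS]cC.
have e : tswap \o tmap f g =1 tmap g f \o tswap.
  by apply: tensor_linearP => a b /=; rewrite !(tmapE, tswapE).
exact: e.
Qed.

End Pairing.

End CoalgebraHom.

Section TensorUnassoc.
Variables (k : fieldType) (V W U X : lmodType k).

(** The inverse of [tassoc]: each [tassoc \o tswap] rotates the three factors cyclically, and after
    two rotations a swap gives the left bracketing. *)
Definition tunassoc : {linear V ⊗ (W ⊗ U) -> (V ⊗ W) ⊗ U} :=
  tswap \o tassoc \o tswap \o tassoc \o tswap.

Lemma tunassoc_tpair (Y : lmodType k) (C : coalgebra Y) (f : {linear Y -> V})
    (g : {linear Y -> W}) (h : {linear Y -> U}) y : cocommutative C ->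
  tunassoc (tpair C f (tpair C g h) y) = tpair C (tpair C f g) h y.
Proof.
move=> cC; rewrite /tunassoc /comp /=.
by rewrite !(tpair_swap _ _ _ cC, tpair_assoc).
Qed.

End TensorUnassoc.

(** The counit applied to both sides of [counitl]. *)
Lemma counit_comul (k : fieldType) (V : lmodType k) (C : coalgebra V) x :
  tunitl (tmap (counit C) (counit C) (comul C x)) = counit C x.
Proof.
rewrite -[in RHS](counitl C x).
have l : tunitl \o tmap (counit C) (counit C) =1
    counit C \o (tunitl \o tmap (counit C) idfun).
  apply: tensor_linearP => a b /=.
  by rewrite !tmapE !tunitlE linearZ.
exact: l.
Qed.

(** * The diagonal of a cocommutative coalgebra *)

Section CocommutativeCoalgebra.
Variables (k : fieldType) (V : lmodType k) (C : coalgebra V).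
Hypothesis cC : cocommutative C.

(** Cocommutativity makes the four Sweedler legs of [x] interchangeable, so exchanging the middle
    factors only exchanges [g] and [h]. *)
Lemma tmid_tpair (W X Y Z : lmodType k) (f : {linear V -> W})
    (g : {linear V -> X}) (h : {linear V -> Y}) (l : {linear V -> Z}) x :
  tmid (tpair C (tpair C f g) (tpair C h l) x) =
  tpair C (tpair C f h) (tpair C g l) x.
Proof.
(* Exchanging the first two of three factors, [s] splits [tmid] into reassociations and swaps, whose
   effect on pairings is known. *)
pose s : {linear X ⊗ (Y ⊗ Z) -> Y ⊗ (X ⊗ Z)} :=
  tmap idfun tswap \o tassoc \o tswap.
have e : tmid =1 @tunassoc k W Y (X ⊗ Z) \o tmap idfun s \o tassoc.
  apply: tensor2_linearP => a b c d /=.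
  by rewrite tmidE tassocE tmapE /= !(tswapE, tassocE, tmapE).
rewrite {}e -[RHS]tunassoc_tpair //.
rewrite -[LHS]/(tunassoc _ _ _ (tmap idfun s (tassoc _))) tpair_assoc tmap_tpair.
congr (tunassoc _ _ _ _); apply: eq_tmap => // y.
rewrite -[LHS]/(tmap idfun tswap (tassoc (tswap _))) tpair_swap // tpair_assoc.
by rewrite tmap_tpair; apply: eq_tmap => // z; exact: tpair_swap.
Qed.

(** Compatibility with the comultiplications is [tmid_tpair] for four identity maps. *)
Lemma coalgebra_hom_comul : coalgebra_hom C (tensor_coalgebra C C) (comul C).
Proof.
have e : comul C =1 tpair C idfun idfun by move=> x; rewrite /= tmap_id.
split=> x; last exact: counit_comul.
have e' y : tmap (comul C) (comul C) y =
    tmap (tpair C idfun idfun) (tpair C idfun idfun) y.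
  exact: eq_tmap.
by rewrite /= e' -[RHS]/(tpair C _ _ x) -tmid_tpair.
Qed.

Lemma coalgebra_hom_tpair (W X : lmodType k) (D : coalgebra W) (E : coalgebra X)
    (f : {linear V -> W}) (g : {linear V -> X}) :
  coalgebra_hom C D f -> coalgebra_hom C E g ->
  coalgebra_hom C (tensor_coalgebra D E) (tpair C f g).
Proof.
move=> hf hg; apply: coalgebra_hom_comp coalgebra_hom_comul.
exact: coalgebra_hom_tmap.
Qed.

End CocommutativeCoalgebra.

(** * The tensor product of coalgebras and its projections *)

Section TensorProjections.
Variables (k : fieldType) (V W : lmodType k) (C : coalgebra V) (D : coalgebra W).

Lemma cocommutative_tensor : cocommutative C -> cocommutative D ->
  cocommutative (tensor_coalgebra C D).
Proof.
move=> cC cD; apply: (@tensor_linearP _ _ _ _ (tswap \o _)) => v w /=.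
have e : tswap \o tmid =1 tmid \o tmap (@tswap k V V) (@tswap k W W).
  by apply: tensor2_linearP => a b c d /=; rewrite !(tmidE, tmapE, tswapE).
have /= := e (comul C v \ox comul D w).
by rewrite !tmapE cC cD.
Qed.

Definition tproj1 : {linear V ⊗ W -> V} := tunitr \o tmap idfun (counit D).
Definition tproj2 : {linear V ⊗ W -> W} := tunitl \o tmap (counit C) idfun.

Lemma tproj1E v w : tproj1 (v \ox w) = counit D w *: v.
Proof. by rewrite /= tmapE tunitrE. Qed.

Lemma tproj2E v w : tproj2 (v \ox w) = counit C v *: w.
Proof. by rewrite /= tmapE tunitlE. Qed.

(** On (v_1 ⊗ w_1) ⊗ (v_2 ⊗ w_2) the projections apply the counits to w_1 and v_2, and the counit
    axioms restore v ⊗ w. *)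
Lemma tpair_tproj t : tpair (tensor_coalgebra C D) tproj1 tproj2 t = t.
Proof.
have e : tmap tproj1 tproj2 \o tmid =1 tmap (tunitr \o tmap idfun (counit C))
      (tunitl \o tmap (counit D) idfun).
  apply: tensor2_linearP => a b c d /=.
  rewrite tmidE !tmapE -/(tproj1 _) -/(tproj2 _) tproj1E tproj2E.
  rewrite /= !tmapE tunitrE tunitlE.
  by rewrite !(tprodZl, tprodZr) scalerA mulrC -scalerA.
elim/tensor_ind: t => [v w|s t IHs IHt]; last by rewrite linearD IHs IHt.
have /= -> := e (tmap (comul C) (comul D) (v \ox w)).
by rewrite !tmapE /= counitl counitr.
Qed.

Lemma coalgebra_hom_tproj1 : coalgebra_hom (tensor_coalgebra C D) C tproj1.
Proof.
split; last first.
  apply: (@tensor_linearP _ _ _ _ (_ \o _)) => v w /=.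
  by rewrite !tmapE tunitrE tunitlE linearZ /= [LHS]mulrC.
apply: (@tensor_linearP _ _ _ _ (_ \o _) (_ \o _)) => v w.
rewrite -[LHS]/(comul C (tproj1 _)).
rewrite -[RHS]/(tmap tproj1 tproj1 (tmid (tmap _ _ _))).
have e : tmap tproj1 tproj1 \o tmid =1
    tunitr \o tmap idfun (tunitl \o tmap (counit D) (counit D)).
  apply: tensor2_linearP => a b c d /=.
  rewrite tmidE !tmapE -/(tproj1 _) !tproj1E /= !tmapE tunitrE /= tunitlE.
  by rewrite tprodZl tprodZr scalerA.
have /= -> := e (tmap (comul C) (comul D) (v \ox w)).
by rewrite !tmapE /= counit_comul !tunitrE linearZ.
Qed.

Lemma coalgebra_hom_tproj2 : coalgebra_hom (tensor_coalgebra C D) D tproj2.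
Proof.
split; last first.
  apply: (@tensor_linearP _ _ _ _ (_ \o _)) => v w /=.
  by rewrite !tmapE !tunitlE linearZ.
apply: (@tensor_linearP _ _ _ _ (_ \o _) (_ \o _)) => v w.
rewrite -[LHS]/(comul D (tproj2 _)).
rewrite -[RHS]/(tmap tproj2 tproj2 (tmid (tmap _ _ _))).
have e : tmap tproj2 tproj2 \o tmid =1
    tunitl \o tmap (tunitl \o tmap (counit C) (counit C)) idfun.
  apply: tensor2_linearP => a b c d /=.
  rewrite tmidE !tmapE -/(tproj2 _) !tproj2E /= !tmapE !tunitlE.
  by rewrite tprodZl tprodZr scalerA.
have /= -> := e (tmap (comul C) (comul D) (v \ox w)).
by rewrite !tmapE /= counit_comul !tunitlE linearZ.
Qed.

End TensorProjections.

(* Generalized [D]-points of [C] in the category of coalgebras. *)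
Record point (k : fieldType) (V W : lmodType k) (D : coalgebra V)
    (C : coalgebra W) := Point {
  point_map :> {linear V -> W};
  point_hom : coalgebra_hom D C point_map
}.

Lemma point_ext (k : fieldType) (V W : lmodType k) (D : coalgebra V)
    (C : coalgebra W) (f g : point D C) : f =1 g -> f = g.
Proof.
case: f g => [f hf] [g hg] /= /linear_ext fg.
by move: hg; rewrite -fg => hg; rewrite (Prop_irrelevance hf hg).
Qed.

(** * The convolution heap of coalgebra maps into a Hopf heap *)

Section PointHeap.
Variables (k : fieldType) (V : lmodType k) (C : coalgebra V) (B : hopf_heap C).
Hypothesis cC : cocommutative C.

(** By cocommutativity [cop C] and [C] have the same comultiplication, so the bracket is an
    operation on [C] in the category of cocommutative coalgebras. *)
Lemma coalgebra_hom_bracket :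
  coalgebra_hom (tensor_coalgebra C (tensor_coalgebra C C)) C (bracket B).
Proof.
have [bD be] := bracket_hom B; split=> [t|]; last exact: be.
rewrite bD; congr (tmap _ _ (tmid _)); apply: eq_tmap => // s /=.
by apply: (congr1 tmid); apply: eq_tmap => // x; exact: cC.
Qed.

Section Domain.
Variables (W : lmodType k) (D : coalgebra W).
Hypothesis cD : cocommutative D.
Implicit Types f g h p q : point D C.

(** The convolution x ↦ [f(x_1), g(x_2), h(x_3)], written with nested pairings so that the rules for
    [tpair] apply. *)
Definition point_op_map f g h : {linear W -> V} :=
  bracket B \o tpair D f (tpair D g h).

Lemma point_op_hom f g h : coalgebra_hom D C (point_op_map f g h).
Proof.
apply: coalgebra_hom_comp coalgebra_hom_bracket _.
apply: coalgebra_hom_tpair => //; first exact: point_hom.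
by apply: coalgebra_hom_tpair => //; exact: point_hom.
Qed.

Definition point_op f g h : point D C := Point (point_op_hom f g h).

Lemma point_opA f g h p q :
  point_op (point_op f g h) p q = point_op f g (point_op h p q).
Proof.
apply: point_ext => x.
rewrite -[LHS]/(bracket B
  (tpair D (bracket B \o tpair D f (tpair D g h)) (tpair D p q) x)).
(* Rebracketing five factors to the right lets [heapA] be stated as an equality [e] of linear
   maps. *)
pose r : {linear (V ⊗ (V ⊗ V)) ⊗ (V ⊗ V) -> V ⊗ (V ⊗ (V ⊗ (V ⊗ V)))} :=
  tmap idfun tassoc \o tassoc.
have e : bracket B \o tmap (bracket B) idfun =1
    bracket B \o tmap idfun (tmap idfun (bracket B)) \o r.
  apply: tensor2_linearP => a s d t /=.
  elim/tensor_ind: s => [b c|s s' IH IH']; last first.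
    by rewrite !(tprodDl, tprodDr, linearD) IH IH'.
  rewrite tassocE !tmapE /= tassocE !tmapE; exact: heapA.
have -> : tpair D (bracket B \o tpair D f (tpair D g h)) (tpair D p q) x =
    tmap (bracket B) idfun (tpair D (tpair D f (tpair D g h)) (tpair D p q) x).
  by rewrite tmap_tpair; apply: eq_tmap.
have -> y : bracket B (tmap (bracket B) idfun y) =
    bracket B (tmap idfun (tmap idfun (bracket B)) (r y)) by exact: e.
have -> : r (tpair D (tpair D f (tpair D g h)) (tpair D p q) x) =
    tpair D f (tpair D g (tpair D h (tpair D p q))) x.
  rewrite -[LHS]/(tmap idfun tassoc (tassoc _)) tpair_assoc tmap_tpair.
  by apply: eq_tmap => // y; exact: tpair_assoc.
apply: (congr1 (bracket B)); rewrite tmap_tpair; apply: eq_tmap => // y.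
rewrite -[LHS]/(tmap idfun (bracket B) (tpair D g (tpair D h (tpair D p q)) y)).
by rewrite tmap_tpair; apply: eq_tmap.
Qed.

(** As [f] is a coalgebra map, f(x_2) ⊗ f(x_3) is the comultiplication of one value of [f], and
    [heapr] turns it into a counit. *)
Lemma point_opr f g : point_op g f f = g.
Proof.
apply: point_ext => x; have [fD fe] := point_hom f.
rewrite -[LHS]/(bracket B (tpair D g (tpair D f f) x)).
have e : tpair D f f =1 comul C \o f by move=> y /=; rewrite fD.
have -> : tpair D g (tpair D f f) x = tmap g (comul C \o f) (comul D x).
  exact: eq_tmap.
rewrite -[in RHS](counitr D x).
have l : bracket B \o tmap g (comul C \o f) =1
    g \o (tunitr \o tmap idfun (counit D)).
  apply: tensor_linearP => a b /=.
  by rewrite !tmapE heapr tunitrE linearZ fe.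
exact: l.
Qed.

Lemma point_opl f g : point_op f f g = g.
Proof.
apply: point_ext => x; have [fD fe] := point_hom f.
rewrite -[LHS]/(bracket B (tpair D f (tpair D f g) x)) -tpair_assoc.
have e : tpair D f f =1 comul C \o f by move=> y /=; rewrite fD.
have -> : tpair D (tpair D f f) g x = tmap (comul C \o f) g (comul D x).
  exact: eq_tmap.
rewrite -[in RHS](counitl D x).
have l : bracket B \o tassoc \o tmap (comul C \o f) g =1
    g \o (tunitl \o tmap (counit D) idfun).
  apply: tensor_linearP => a b /=.
  by rewrite !tmapE heapl tunitlE linearZ fe.
exact: l.
Qed.

Lemma point_opC f g h : heap_commutative B -> point_op f g h = point_op h g f.
Proof.
move=> cB; apply: point_ext => x.
have e : bracket B =1 bracket B \o tassoc \o tswap \o tmap idfun tswap.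
  apply: tensor_linearP => a t /=; elim/tensor_ind: t => [b c|s t IHs IHt].
    rewrite tmapE !tswapE tassocE; exact: cB.
  by rewrite !(tprodDr, linearD) IHs IHt.
rewrite -[LHS]/(bracket B (tpair D f (tpair D g h) x)) e /=.
rewrite -[tmap f _ _]/(tpair D _ _ x) tmap_tpair tpair_swap // .
rewrite (_ : tpair D _ _ x = tpair D (tpair D h g) f x).
  by rewrite tpair_assoc.
by apply: eq_tmap => // y; exact: tpair_swap.
Qed.

Lemma point_op_medial : heap_commutative B ->
  forall a b c d e f g h i,
    point_op (point_op a b c) (point_op d e f) (point_op g h i) =
    point_op (point_op a d g) (point_op b e h) (point_op c f i).
Proof.
move=> cB; apply: heap_medial => *.
- exact: point_opA.
- exact: point_opl.
- exact: point_opr.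
- exact: point_opC.
Qed.

End Domain.
End PointHeap.

Definition point_comp (k : fieldType) (V W U : lmodType k) (C : coalgebra V)
    (D : coalgebra W) (E : coalgebra U) (f : point D E) (g : point C D) :
    point C E :=
  Point (coalgebra_hom_comp (point_hom f) (point_hom g)).

(** * The heap and the composition on endomorphisms *)

Section Endomorphisms.
Variables (k : fieldType) (V : lmodType k) (C : coalgebra V) (B : hopf_heap C).
Hypothesis cC : cocommutative C.
Hypothesis cB : heap_commutative B.
Implicit Types alpha beta gamma : heap_endo B.

Definition endo_point alpha : point C C := Point (endo_coalgebra_hom alpha).

Lemma endo_bracket alpha t :
  alpha (bracket B t) = bracket B (tmap alpha (tmap alpha alpha) t).
Proof.
apply: (@tensor_linearP _ _ _ _ (alpha \o bracket B) (bracket B \o _)) => a s /=.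
elim/tensor_ind: s => [b c|s s' IH IH']; last first.
  by rewrite !(tprodDr, linearD) IH IH'.
by rewrite !tmapE; exact: endo_heap.
Qed.

Section Naturality.
Variables (W : lmodType k) (D : coalgebra W).
Hypothesis cD : cocommutative D.
Implicit Types f g h : point D C.

(** Precomposition with a coalgebra map passes through pairings, so convolution is natural in its
    domain. *)
Lemma point_op_comp (U : lmodType k) (E : coalgebra U) (cE : cocommutative E)
    (u : point E D) f g h :
  point_comp (point_op B cC cD f g h) u =
  point_op B cC cE (point_comp f u) (point_comp g u) (point_comp h u).
Proof.
apply: point_ext => x; apply: (congr1 (bracket B)).
rewrite (tpair_comp _ _ _ (point_hom u)); apply: eq_tmap => // y.
exact: (tpair_comp _ _ _ (point_hom u)).
Qed.

Lemma endo_point_op alpha f g h :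
  let a := endo_point alpha in
  point_comp a (point_op B cC cD f g h) =
  point_op B cC cD (point_comp a f) (point_comp a g) (point_comp a h).
Proof.
apply: point_ext => x; apply: etrans (endo_bracket _ _) _.
apply: (congr1 (bracket B)); rewrite tmap_tpair; apply: eq_tmap => // y.
exact: tmap_tpair.
Qed.

End Naturality.

Lemma endo_op_heap alpha beta gamma a b c :
  let d :=
    point_op B cC cC (endo_point alpha) (endo_point beta) (endo_point gamma) in
  d (heap (bracket B) a b c) = heap (bracket B) (d a) (d b) (d c).
Proof.
move=> d; pose CC := tensor_coalgebra C C; pose D := tensor_coalgebra C CC.
have cCC : cocommutative CC by exact: cocommutative_tensor.
have cD : cocommutative D by exact: cocommutative_tensor.
pose p23 := Point (coalgebra_hom_tproj2 C CC).
pose p1 := Point (coalgebra_hom_tproj1 C CC).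
pose p2 := point_comp (Point (coalgebra_hom_tproj1 C C)) p23.
pose p3 := point_comp (Point (coalgebra_hom_tproj2 C C)) p23.
have pE t : tpair D p1 (tpair D p2 p3) t = t.
  rewrite -[RHS](tpair_tproj C CC); apply: eq_tmap => // y.
  rewrite -[RHS](tpair_tproj C C); apply/esym.
  exact: (tpair_comp _ _ _ (point_hom p23)).
(* The projections act as three generic elements, so an identity about their bracket specializes to
   all [a], [b], [c]. *)
have opE : point_op B cC cD p1 p2 p3 = Point (coalgebra_hom_bracket B cC).
  by apply: point_ext => t; apply: (congr1 (bracket B)); exact: pE.
have dE : point_comp d (Point (coalgebra_hom_bracket B cC)) =
    point_op B cC cD (point_comp d p1) (point_comp d p2) (point_comp d p3).
  (* The array has one row for each of [alpha], [beta], [gamma] and one column for each projection;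
     the two sides bracket it by rows and by columns. *)
  by rewrite -opE !(point_op_comp _ cD) !endo_point_op point_op_medial.
rewrite /heap -[LHS]/(point_comp d (Point (coalgebra_hom_bracket B cC)) _) dE.
apply: (congr1 (bracket B)).
have -> : d a \ox (d b \ox d c) = tmap d (tmap d d) (a \ox (b \ox c)).
  by rewrite !tmapE.
rewrite -[a \ox (b \ox c) in RHS]pE tmap_tpair.
by apply: eq_tmap => // y; apply/esym; exact: tmap_tpair.
Qed.

Definition endo_op alpha beta gamma : heap_endo B :=
  HeapEndo (point_hom (point_op B cC cC
      (endo_point alpha) (endo_point beta) (endo_point gamma)))
    (endo_op_heap alpha beta gamma).

Lemma endo_opE alpha beta gamma x :
  endo_op alpha beta gamma x =
  bracket B (tmap alpha (tmap beta gamma) (comul3 C x)).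
Proof.
by apply: (congr1 (bracket B)); rewrite /comul3 /= tmap_comp; exact: eq_tmap.
Qed.

(** Transfers the heap identities from coalgebra maps [C -> C] to [heap_endo B]. *)
Lemma endo_point_inj : injective endo_point.
Proof.
by move=> f g fg; apply: heap_endoP => x; rewrite -[f x]/(endo_point f x) fg.
Qed.

Lemma endo_point_endo_op alpha beta gamma :
  endo_point (endo_op alpha beta gamma) =
  point_op B cC cC (endo_point alpha) (endo_point beta) (endo_point gamma).
Proof. exact: point_ext. Qed.

Lemma endo_opA a b c d e :
  endo_op (endo_op a b c) d e = endo_op a b (endo_op c d e).
Proof. by apply: endo_point_inj; rewrite !endo_point_endo_op point_opA. Qed.

Lemma endo_opl a b : endo_op a a b = b.
Proof. by apply: endo_point_inj; rewrite !endo_point_endo_op point_opl. Qed.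

Lemma endo_opr a b : endo_op b a a = b.
Proof. by apply: endo_point_inj; rewrite !endo_point_endo_op point_opr. Qed.

Lemma endo_comp_heap alpha beta a b c :
  (alpha \o beta) (heap (bracket B) a b c) =
  heap (bracket B) ((alpha \o beta) a) ((alpha \o beta) b) ((alpha \o beta) c).
Proof. by rewrite /= !endo_heap. Qed.

Definition endo_comp alpha beta : heap_endo B :=
  HeapEndo (coalgebra_hom_comp (endo_coalgebra_hom alpha)
      (endo_coalgebra_hom beta))
    (endo_comp_heap alpha beta).

Lemma endo_compA alpha beta gamma :
  endo_comp alpha (endo_comp beta gamma) = endo_comp (endo_comp alpha beta) gamma.
Proof. exact: heap_endoP. Qed.

(** The case [D = C] of [endo_point_op]. *)
Lemma endo_comp_op a b c d :
  endo_comp a (endo_op b c d) =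
  endo_op (endo_comp a b) (endo_comp a c) (endo_comp a d).
Proof.
apply: endo_point_inj; rewrite endo_point_endo_op.
rewrite (_ : endo_point (endo_comp _ _) =
    point_comp (endo_point a) (endo_point (endo_op b c d))).
  by rewrite endo_point_endo_op endo_point_op; apply: point_ext.
exact: point_ext.
Qed.

(** Serves as the base point that gives the free module on [heap_endo B] a group-like element. *)
Definition endo_id : heap_endo B :=
  @HeapEndo _ _ _ B idfun (coalgebra_hom_id C) (fun _ _ _ => erefl).

End Endomorphisms.

(** * The set-like coalgebra on a free module *)

HB.lock Definition malg_comul (k : fieldType) (T : choiceType) :
  {linear {malg k[T]} -> {malg k[T]} ⊗ {malg k[T]}} :=
  malg_lift (fun x => << x >> \ox << x >>).

HB.lock Definition malg_counit (k : fieldType) (T : choiceType) :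
  {linear {malg k[T]} -> k^o} := malg_lift (fun _ => 1).

Section SetLikeCoalgebra.
Variables (k : fieldType) (T : choiceType) (x0 : T).
Local Notation M := {malg k[T]}.

Local Notation malg_comul := (malg_comul k T).
Local Notation malg_counit := (malg_counit k T).

Lemma malg_comulE x : malg_comul << x >> = << x >> \ox << x >>.
Proof. by rewrite malg_comul.unlock; exact: malg_liftU. Qed.

Lemma malg_counitE x : malg_counit << x >> = 1.
Proof. by rewrite malg_counit.unlock; exact: malg_liftU. Qed.

Lemma malg_linear_ind (P : M -> Prop) :
  (forall x, P << x >>) -> (forall a u v, P u -> P v -> P (a *: u + v)) ->
  forall u, P u.
Proof.
move=> PU PP u; have P0 : P 0.
  (* The base point yields [0] as [-1 *: << x0 >> + << x0 >>]. *)
  by have := PP (-1) _ _ (PU x0) (PU x0); rewrite scaleN1r addNr.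
rewrite [u]monalgE; elim/big_rec: _ => [//|x v _ Pv].
suff -> : << u@_x *g x >> = u@_x *: << x >> :> M by exact: PP.
by apply/malgP => z; rewrite mcoeffZ !mcoeffU mulrnAr mulr1.
Qed.

Lemma malg_linearP (U : lmodType k) (f g : {linear M -> U}) :
  (forall x, f << x >> = g << x >>) -> f =1 g.
Proof.
by move=> fg; elim/malg_linear_ind=> // a u v fgu fgv; rewrite !linearP fgu fgv.
Qed.

Fact malg_comulA u : tassoc (tmap malg_comul idfun (malg_comul u)) =
  tmap idfun malg_comul (malg_comul u).
Proof.
apply: (malg_linearP (f := tassoc \o tmap malg_comul idfun \o malg_comul)
  (g := tmap idfun malg_comul \o malg_comul)) => x.
by rewrite /= malg_comulE !tmapE malg_comulE tassocE.
Qed.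

Fact malg_counitl u : tunitl (tmap malg_counit idfun (malg_comul u)) = u.
Proof.
apply: (malg_linearP (f := tunitl \o tmap malg_counit idfun \o malg_comul)
  (g := idfun)) => x.
by rewrite /= malg_comulE tmapE malg_counitE tunitlE scale1r.
Qed.

Fact malg_counitr u : tunitr (tmap idfun malg_counit (malg_comul u)) = u.
Proof.
apply: (malg_linearP (f := tunitr \o tmap idfun malg_counit \o malg_comul)
  (g := idfun)) => x.
by rewrite /= malg_comulE tmapE malg_counitE tunitrE scale1r.
Qed.

Fact malg_grouplike : exists g, malg_comul g = g \ox g /\ malg_counit g = 1.
Proof. by exists << x0 >>; rewrite malg_comulE malg_counitE. Qed.

Definition malg_coalgebra : coalgebra M :=
  Coalgebra malg_comulA malg_counitl malg_counitr malg_grouplike.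

End SetLikeCoalgebra.

(** * Multilinear extension of set-level operations *)

Section BilinearExtension.
Variables (k : fieldType) (S T : choiceType) (U : lmodType k) (f : S -> T -> U).

Definition malg_bilift (u : {malg k[S]}) (v : {malg k[T]}) : U :=
  malg_lift (fun x => malg_lift (f x) v) u.

Fact malg_bilift_is_bilinear : bilinear_for *:%R *:%R malg_bilift.
Proof.
split=> [v a u u'|u a v v']; rewrite /malg_bilift; first by rewrite linearP.
have E F : malg_lift F u = \sum_(x <- msupp u) u@_x *: F x :> U by [].
rewrite !E /= scaler_sumr -big_split; apply: eq_bigr => x _.
by rewrite linearP scalerDr !scalerA mulrC.
Qed.

HB.instance Definition _ := bilinear_isBilinear.Build k {malg k[S]} {malg k[T]} U
  _ _ malg_bilift malg_bilift_is_bilinear.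

Definition malg_lift2 : {linear {malg k[S]} ⊗ {malg k[T]} -> U} :=
  tlift malg_bilift.

Lemma malg_lift2U x y : malg_lift2 (<< x >> \ox << y >>) = f x y.
Proof. by rewrite /malg_lift2 tliftE /= /malg_bilift !malg_liftU. Qed.

End BilinearExtension.

(** The last two arguments are first encoded in the free module on [T * T], so that two bilinear
    extensions give a trilinear one. *)
HB.lock Definition malg_bracket (k : fieldType) (T : choiceType)
    (op : T -> T -> T -> T) :
    {linear {malg k[T]} ⊗ ({malg k[T]} ⊗ {malg k[T]}) -> {malg k[T]}} :=
  malg_lift2 (fun x (p : T * T) => << op x p.1 p.2 >>) \o
  tmap idfun (malg_lift2 (fun y z => << (y, z) >>)).

HB.lock Definition malg_mul (k : fieldType) (T : choiceType) (mul : T -> T -> T) :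
    {linear {malg k[T]} ⊗ {malg k[T]} -> {malg k[T]}} :=
  malg_lift2 (fun x y => << mul x y >>).

(** * Linearization of a set-level heap, semigroup and truss *)

Section SetLikeHeap.
Variables (k : fieldType) (T : choiceType) (x0 : T).
Local Notation M := {malg k[T]}.
Local Notation K := (malg_coalgebra k x0).

Let basis_ind := @malg_linear_ind k T x0.

Lemma malg2_linearP (U : lmodType k) (f g : {linear M ⊗ M -> U}) :
  (forall x y, f (<< x >> \ox << y >>) = g (<< x >> \ox << y >>)) -> f =1 g.
Proof.
move=> fg; apply: tensor_linearP.
elim/basis_ind => [x|a u u' IH IH'] v; last by rewrite tprodPl !linearP IH IH'.
elim/basis_ind: v => [//|a v v' IH IH'].
by rewrite tprodPr !linearP IH IH'.
Qed.

Lemma malg3_linearP (U : lmodType k) (f g : {linear M ⊗ (M ⊗ M) -> U}) :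
  (forall x y z, f (<< x >> \ox (<< y >> \ox << z >>)) =
                 g (<< x >> \ox (<< y >> \ox << z >>))) -> f =1 g.
Proof.
move=> fg; apply: tensor_linearP => u t.
elim/tensor_ind: t => [v w|s t IH IH']; last by rewrite tprodDr !linearD IH IH'.
elim/basis_ind: u => [x|a u u' IH IH']; last by rewrite tprodPl !linearP IH IH'.
elim/basis_ind: v => [y|a v v' IH IH']; last first.
  by rewrite tprodPl tprodPr !linearP IH IH'.
elim/basis_ind: w => [//|a w w' IH IH'].
by rewrite !tprodPr !linearP IH IH'.
Qed.

Section Heap.
Variable op : T -> T -> T -> T.
Hypothesis opA : forall a b c d e, op (op a b c) d e = op a b (op c d e).
Hypothesis opl : forall a b, op a a b = b.
Hypothesis opr : forall a b, op b a a = b.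

Local Notation malg_bracket := (malg_bracket k op).

Lemma malg_bracketU x y z :
  malg_bracket (<< x >> \ox (<< y >> \ox << z >>)) = << op x y z >>.
Proof. by rewrite malg_bracket.unlock /= tmapE !malg_lift2U. Qed.

(** Basis elements are group-like, and the swap in [cop] fixes [<< y >> \ox << y >>]. *)
Fact malg_bracket_hom :
  coalgebra_hom (tensor_coalgebra K (tensor_coalgebra (cop K) K)) K malg_bracket.
Proof.
split.
  apply: (malg3_linearP (f := malg_comul k T \o malg_bracket)
    (g := tmap malg_bracket malg_bracket \o
          tensor_comul K (tensor_coalgebra (cop K) K))) => x y z.
  rewrite /= malg_bracketU malg_comulE !tmapE /= !tmapE /=.
  by rewrite !malg_comulE tswapE !tmidE tmapE !malg_bracketU.
apply: (malg3_linearP (f := malg_counit k T \o malg_bracket)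
    (g := tensor_counit K (tensor_coalgebra (cop K) K))) => x y z.
rewrite /= malg_bracketU !tmapE /= !tmapE /=.
by rewrite !malg_counitE !tunitlE !scale1r.
Qed.

Fact malg_bracketA a b c d e :
  heap malg_bracket (heap malg_bracket a b c) d e =
  heap malg_bracket a b (heap malg_bracket c d e).
Proof.
rewrite /heap.
elim/basis_ind: a => [x|r u v IH IH']; last first.
  by rewrite !(tprodPl, tprodPr, linearP) IH IH'.
elim/basis_ind: b => [y|r u v IH IH']; last first.
  by rewrite !(tprodPl, tprodPr, linearP) IH IH'.
elim/basis_ind: c => [z|r u v IH IH']; last first.
  by rewrite !(tprodPl, tprodPr, linearP) IH IH'.
elim/basis_ind: d => [t|r u v IH IH']; last first.
  by rewrite !(tprodPl, tprodPr, linearP) IH IH'.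
elim/basis_ind: e => [s|r u v IH IH']; last first.
  by rewrite !(tprodPl, tprodPr, linearP) IH IH'.
by rewrite !malg_bracketU opA.
Qed.

Fact malg_bracketl c a :
  malg_bracket (tassoc (comul K c \ox a)) = counit K c *: a.
Proof.
elim/basis_ind: c => [x|r u v IH IH']; last first.
  by rewrite linearP tprodPl 2!linearP IH IH' linearP scalerDl scalerA.
elim/basis_ind: a => [y|r u v IH IH']; last first.
  by rewrite tprodPr 2!linearP IH IH' scalerDr !scalerA mulrC.
by rewrite /= malg_comulE malg_counitE tassocE malg_bracketU opl scale1r.
Qed.

Fact malg_bracketr c a :
  malg_bracket (a \ox comul K c) = counit K c *: a.
Proof.
elim/basis_ind: c => [x|r u v IH IH']; last first.
  by rewrite linearP tprodPr linearP IH IH' linearP scalerDl scalerA.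
elim/basis_ind: a => [y|r u v IH IH']; last first.
  by rewrite tprodPl linearP IH IH' scalerDr !scalerA mulrC.
by rewrite /= malg_comulE malg_counitE malg_bracketU opr scale1r.
Qed.

Definition malg_heap : hopf_heap K :=
  HopfHeap malg_bracket_hom malg_bracketA malg_bracketl malg_bracketr.

End Heap.

Section Multiplication.
Variable mul : T -> T -> T.
Hypothesis mulA : associative mul.

Local Notation malg_mul := (malg_mul k mul).

Lemma malg_mulU x y : malg_mul (<< x >> \ox << y >>) = << mul x y >>.
Proof. by rewrite malg_mul.unlock; exact: malg_lift2U. Qed.

Fact malg_mul_hom : coalgebra_hom (tensor_coalgebra K K) K malg_mul.
Proof.
split.
  apply: (malg2_linearP (f := malg_comul k T \o malg_mul)
    (g := tmap malg_mul malg_mul \o tensor_comul K K)) => x y.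
  rewrite /= malg_mulU malg_comulE tmapE /=.
  by rewrite !malg_comulE tmidE tmapE !malg_mulU.
apply: (malg2_linearP (f := malg_counit k T \o malg_mul)
    (g := tensor_counit K K)) => x y.
by rewrite /= malg_mulU tmapE /= !malg_counitE tunitlE scale1r.
Qed.

Fact malg_mulA a b c :
  malg_mul (a \ox malg_mul (b \ox c)) = malg_mul (malg_mul (a \ox b) \ox c).
Proof.
elim/basis_ind: a => [x|r u v IH IH']; last first.
  by rewrite !tprodPl !linearP tprodPl linearP IH IH'.
elim/basis_ind: b => [y|r u v IH IH']; last first.
  by rewrite tprodPl tprodPr !linearP tprodPl tprodPr !linearP IH IH'.
elim/basis_ind: c => [z|r u v IH IH']; last first.
  by rewrite !tprodPr !linearP tprodPr linearP IH IH'.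
by rewrite !malg_mulU mulA.
Qed.

Definition malg_bialgebra : nonunital_bialgebra K :=
  NonunitalBialgebra malg_mul_hom malg_mulA.

End Multiplication.

Section Truss.
Variables (op : T -> T -> T -> T) (mul : T -> T -> T).
Hypothesis mulD : forall a b c d,
  mul a (op b c d) = op (mul a b) (mul a c) (mul a d).

(** On a basis element [comul3] yields three copies of it, which reduces the law to [mulD];
    multilinearity does the rest. *)
Fact malg_distr a b c d : let m := malg_mul k mul in
  m (a \ox heap (malg_bracket k op) b c d) =
  malg_bracket k op (tmap (rmul m b) (tmap (rmul m c) (rmul m d)) (comul3 K a)).
Proof.
move=> m; rewrite /heap.
elim/basis_ind: a => [x|r u v IH IH']; last first.
  by rewrite tprodPl linearP IH IH' !linearP.
rewrite /= malg_comulE tmapE malg_comulE !tmapE /= /rmul.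
elim/basis_ind: b => [y|r u v IH IH']; last first.
  by rewrite tprodPl linearP tprodPr linearP tprodPr linearP tprodPl linearP IH IH'.
elim/basis_ind: c => [z|r u v IH IH']; last first.
  rewrite tprodPl tprodPr linearP tprodPr linearP.
  by rewrite tprodPr linearP tprodPl tprodPr linearP IH IH'.
elim/basis_ind: d => [w|r u v IH IH']; last first.
  rewrite !tprodPr linearP tprodPr linearP.
  by rewrite linearP !tprodPr linearP IH IH'.
by rewrite /m malg_bracketU !malg_mulU malg_bracketU mulD.
Qed.

End Truss.
End SetLikeHeap.

Theorem proposition3p12 (k : fieldType) (H : lmodType k) (C : coalgebra H)
    (B : hopf_heap C) (hcomm : heap_commutative B) (hcocomm : cocommutative C) :
  exists T : hopf_truss {malg k[heap_endo B]},
    [/\ forall alpha : heap_endo B,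
          comul (truss_coalgebra T) << alpha >> = << alpha >> \ox << alpha >>,
        forall alpha beta : heap_endo B,
          exists2 gamma : heap_endo B,
            gamma =1 alpha \o beta &
            bialg_mul (truss_bialgebra T) (<< alpha >> \ox << beta >>) =
              << gamma >>
      & forall alpha beta gamma : heap_endo B,
          exists2 delta : heap_endo B,
            forall x, delta x =
              bracket B (tmap alpha (tmap beta gamma) (comul3 C x)) &
            heap (bracket (truss_heap T)) << alpha >> << beta >> << gamma >> =
              << delta >>].
Proof.
pose op := endo_op hcocomm hcomm.
exists (HopfTruss
  (truss_heap := malg_heap k (endo_id B) (endo_opA hcocomm hcomm)
    (endo_opl hcocomm hcomm) (endo_opr hcocomm hcomm))
  (truss_bialgebra := malg_bialgebra k (endo_id B) (@endo_compA _ _ _ B))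
  (malg_distr (endo_id B) (endo_comp_op hcocomm hcomm))).
split=> [alpha|alpha beta|alpha beta gamma].
- exact: malg_comulE.
- by exists (endo_comp alpha beta) => //; exact: malg_mulU.
- exists (op alpha beta gamma); first exact: endo_opE.
  exact: malg_bracketU.
Qed.
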